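(* Assume the setting of the context: conditions (C.1)–(C.5) hold, $\alpha>0$, $\rho>0$, and $\hat\theta_n\in\arg\min_{\theta\in\Theta}\{\hat R_{\psi_\lambda,l,\alpha}(\theta)+\rho\|\theta\|_2^2\}$. Let $\delta\in(0,1/2)$ and $\kappa>0$. Then, with probability at least $1-2\delta$, $$R_l(\hat\theta_n)-\inf_{\theta\in\Theta}R_l(\theta)\le 2\kappa\Big\{\mathbb{E}H_{Y,X}+\frac{c_2 f(\alpha\kappa)}{\alpha\kappa}\mathbb{E}[\lambda(H_{Y,X})]\Big\}+\frac{(c_2+1)f(\alpha)}{\alpha}R_{\lambda\circ l}(\Theta)+\frac{1}{n\alpha}\log\frac{N(\Theta,\kappa)}{\delta^2}+\rho\|\Theta^*\|_2^2 .$$ In particular, take $\kappa=1/n$ and let $\alpha=f^{-1}\Big(\frac{1}{n(c_2+1)}[R_{\lambda\circ l}(\Theta)]^{-1}\log\frac{N(\Theta,n^{-1})}{\delta^2}\Big)$, i.e. $\alpha>0$ is such that $f(\alpha)=\frac{1}{n(c_2+1)R_{\lambda\circ l}(\Theta)}\log\frac{N(\Theta,n^{-1})}{\delta^2}$. Then, with probability at least $1-2\delta$, $$R_l(\hat\theta_n)-\inf_{\theta\in\Theta}R_l(\theta)\le\frac{2\,\mathbb{E}H_{Y,X}}{n}+\frac{c_2\,\mathbb{E}[\lambda(H_{Y,X})]}{\alpha}f\Big(\frac{\alpha}{n}\Big)+\frac{2}{n\alpha}\log\frac{N(\Theta,n^{-1})}{\delta^2}+\rho\|\Theta^*\|_2^2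 .$$
   Context: Data and loss: $(X_1,Y_1),\dots,(X_n,Y_n)$ are i.i.d. copies of an $\mathbb{R}^d\times\mathbb{R}$-valued random variable $(X,Y)$. The loss is a (measurable) real function $l(y,x,\theta)$, $y\in\mathbb{R}$, $x\in\mathbb{R}^d$, $\theta\in\Theta\subset\mathbb{R}^p$. Put $R_l(\theta)=\mathbb{E}[l(Y,X,\theta)]$, $\Theta^*=\arg\min_{\theta\in\Theta}R_l(\theta)$ (the set of all minimizers), $\|\Theta^*\|_2=\inf_{\theta^*\in\Theta^*}\|\theta^*\|_2$. Conditions: (C.1) $\lambda:\mathbb{R}_+\to\mathbb{R}_+$ is continuous and non-decreasing with $\lim_{x\to\infty}\lambda(x)/x=\infty$ (extended by continuity at $0$), and there are a constant $c_2>0$ and a function $f:\mathbb{R}_+\to\mathbb{R}_+$ such that (C.1.1) $\lambda(tx)\le f(t)\lambda(x)$ for all $t,x\in\mathbb{R}_+$, where $\lim_{t\to0^+}f(t)/t=0$; (C.1.2) $\lambda(x+y)\le c_2[\lambda(x)+\lambda(y)]$ for all $x,y\in\mathbb{R}_+$. (C.2) $\Theta\subseteq\mathbb{R}^p$ is convex and there is $r_n\in(0,\infty)$ (possibly depending on $n$) with $\|\theta\|_2\le r_n$ for all $\theta\in\Theta$. (C.3) There is $H_{y,x}\ge0$ with $|l(y,x,\theta_2)-l(y,x,\theta_1)|\le H_{y,x}\|\theta_2-\theta_1\|_2$ for all $\theta_1,\theta_2\in\Theta$. (C.4) $\mathbb{E}[\lambda(H_{Y,X})]<\infty$. (C.5)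 $R_{\lambda\circ l}(\Theta):=\sup_{\theta\in\Theta}R_{\lambda\circ l}(\theta)<\infty$, where $R_{\lambda\circ l}(\theta):=\mathbb{E}\{\lambda(|l(Y,X,\theta)|)\}$. Truncation: $\psi_\lambda:\mathbb{R}\to\mathbb{R}$ is a non-decreasing function with $-\log[1-x+\lambda(|x|)]\le\psi_\lambda(x)\le\log[1+x+\lambda(|x|)]$ for all $x\in\mathbb{R}$. For $\alpha>0$, $\hat R_{\psi_\lambda,l,\alpha}(\theta)=\frac{1}{n\alpha}\sum_{i=1}^n\psi_\lambda[\alpha l(Y_i,X_i,\theta)]$. Minimizers $\hat\theta_n$ are assumed to exist (any measurable choice). Covering number: $N(\Theta,\varepsilon)$ is the smallest number of closed Euclidean balls of radius $\varepsilon$ with centers in $\Theta$ whose union covers $\Theta$. *)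

(* Defs.v *)
From HB Require Import structures.
From mathcomp Require Export all_boot all_order all_algebra.
From mathcomp Require Export all_classical all_reals all_analysis.
Export Order.TTheory GRing.Theory Num.Theory.
Export numFieldNormedType.Exports.

Set Implicit Arguments.
Unset Strict Implicit.
Unset Printing Implicit Defensive.

Local Open Scope classical_set_scope.
Local Open Scope ring_scope.

(* The library norm on 'rV is the sup norm, so the Euclidean one is spelled
   out; both induce the same topology. *)
Definition norm2 (R : realType) (k : nat) (x : 'rV[R]_k) : R :=
  Num.sqrt (\sum_(j < k) x ord0 j ^+ 2).

(* 'rV[R]_k with its Borel sigma-algebra. *)
Definition borelRV (R : realType) (k : nat) :=
  g_sigma_algebraType (@open 'rV[R]_k).

Definition argmin (T : Type) (disp : Order.disp_t) (V : porderType disp)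
    (A : set T) (g : T -> V) : set T :=
  [set x | A x /\ forall y, A y -> (g x <= g y)%O].

Definition covered_by (R : realType) (p : nat) (A : set 'rV[R]_p) (e : R)
    (k : nat) : Prop :=
  exists c : 'I_k -> 'rV[R]_p,
    (forall i, A (c i)) /\ (forall x, A x -> exists i, norm2 (x - c i) <= e).

(* The least element of [set k | covered_by A e k]; the default value 0 is
   only used when there is no finite cover, which cannot happen for a bounded
   A and e > 0. *)
Definition covering_number (R : realType) (p : nat) (A : set 'rV[R]_p)
    (e : R) : nat :=
  xget 0%N [set k | covered_by A e k /\
                    forall j, covered_by A e j -> (k <= j)%N].

Definition mutually_independent (d d' : measure_display)
    (Omega : measurableType d) (T : measurableType d') (R : realType)
    (P : probability Omega R) (n : nat) (Z : 'I_n -> {mfun Omega >-> T}) :=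
  forall (J : {set 'I_n}) (A : 'I_n -> set T),
    (forall i, measurable (A i)) ->
    P (\bigcap_(i in [set` J]) (Z i @^-1` A i)) =
    (\prod_(i in J) P (Z i @^-1` A i))%E.

Definition iid_copies (d d' : measure_display)
    (Omega : measurableType d) (T : measurableType d') (R : realType)
    (P : probability Omega R) (Z0 : {mfun Omega >-> T})
    (n : nat) (Z : 'I_n -> {mfun Omega >-> T}) :=
  mutually_independent P Z /\
  forall i (A : set T), measurable A ->
    distribution P (Z i) A = distribution P Z0 A.

(* lambda and f are functions on the half-line: only their values at
   nonnegative (lambda), resp. positive (f), arguments matter. *)
Definition growth_condition (R : realType) (lambda f : R -> R) (c2 : R) :=
  [/\ (forall x : R, 0 <= x -> 0 <= lambda x),
      {within `[0, +oo[, continuous lambda},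
      {in `[0, +oo[ &, {homo lambda : x y / x <= y}} &
      lambda x / x @[x --> +oo] --> +oo] /\
  [/\ 0 < c2,
      (forall t : R, 0 < t -> 0 <= f t),
      (forall t x : R, 0 < t -> 0 < x -> lambda (t * x) <= f t * lambda x),
      f t / t @[t --> 0^'+] --> (0 : R) &
      (forall x y : R, 0 <= x -> 0 <= y ->
         lambda (x + y) <= c2 * (lambda x + lambda y))].

(* As [ln] is 0 on nonpositive reals, the positivity of the arguments of the
   logarithms, needed for the two bounds to make sense, is explicit. *)
Definition truncation_function (R : realType) (lambda psi : R -> R) :=
  {homo psi : x y / x <= y} /\
  forall x,
    [/\ 0 < 1 - x + lambda `|x|, 0 < 1 + x + lambda `|x|,
        - ln (1 - x + lambda `|x|) <= psi x &
        psi x <= ln (1 + x + lambda `|x|)].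

(* An observation is a pair z = (x, y), while losses take y first. *)
Definition loss_at (R : realType) (k p : nat)
    (l : R -> 'rV[R]_k -> 'rV[R]_p -> R) (theta : 'rV[R]_p)
    (z : borelRV R k * R) : R :=
  l z.2 z.1 theta.

Section Risk.
Context (d : measure_display) (Omega : measurableType d) (R : realType)
  (P : probability Omega R) (k p : nat).
Variables (Z0 : {mfun Omega >-> (borelRV R k * R)%type})
  (l : R -> 'rV[R]_k -> 'rV[R]_p -> R).

Definition risk (theta : 'rV[R]_p) : \bar R :=
  'E_P[fun w => loss_at l theta (Z0 w)]%E.

Definition lrisk (lambda : R -> R) (theta : 'rV[R]_p) : \bar R :=
  'E_P[fun w => (lambda `|loss_at l theta (Z0 w)|)%R]%E.

Definition sup_lrisk (lambda : R -> R) (Theta : set 'rV[R]_p) : \bar R :=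
  ereal_sup [set lrisk lambda theta | theta in Theta].

(* Equal to +oo when the risk has no minimizer in Theta. *)
Definition norm_argmin_risk (Theta : set 'rV[R]_p) : \bar R :=
  ereal_inf [set (norm2 theta)%:E | theta in argmin Theta risk].

Definition excess_risk (Theta : set 'rV[R]_p) (theta : 'rV[R]_p) : \bar R :=
  (risk theta - ereal_inf [set risk theta' | theta' in Theta])%E.

End Risk.

Definition emp_risk (d : measure_display) (Omega : measurableType d)
    (R : realType) (k p n : nat)
    (Z : 'I_n -> {mfun Omega >-> (borelRV R k * R)%type})
    (l : R -> 'rV[R]_k -> 'rV[R]_p -> R) (psi : R -> R) (alpha : R)
    (w : Omega) (theta : 'rV[R]_p) : R :=
  (n%:R * alpha)^-1 * \sum_(i < n) psi (alpha * loss_at l theta (Z i w)).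

(* Main.v *)
Require Import Defs.
From mathcomp Require Import measurable_realfun ring lra.

(* For g = 1 + alpha l(theta) + lambda(|alpha l(theta)|) one has
   psi(alpha l(theta)) <= ln g, so Markov's inequality applied to the product
   of the independent factors g(Z_i), whose mean is at most exp(n (E g - 1)),
   bounds the empirical risk at a minimizer theta* from above. In the same way
   psi(x) >= - ln(1 - x + lambda(|x|)) at x = alpha l(c) - alpha kappa H bounds
   the empirical risk from below, simultaneously for all theta in the ball of
   radius kappa around c, because psi is monotone and l(theta) >= l(c) - kappa H
   there; a union bound over the centers of a minimal kappa-net makes this
   uniform over Theta. Comparing both bounds through the minimality of thetahat
   gives the oracle inequality. *)

Set Implicit Arguments.
Unset Strict Implicit.
Unset Printing Implicit Defensive.

Import HBNNSimple.

Local Open Scope classical_set_scope.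
Local Open Scope ring_scope.

(** * Products of independent factors and an exponential Markov bound *)

(** The identity for indicators extends to simple functions by linearity, then to [h] by monotone
    convergence. In the product formula below, [G] is the product of all factors but one. *)
Lemma integral_weighted_comp (d d' : measure_display)
    (Omega : measurableType d) (T : measurableType d') (R : realType)
    (mu : {measure set Omega -> \bar R}) (X : {mfun Omega >-> T})
    (G : Omega -> R) (c : R) (h : T -> R) :
  measurable_fun [set: Omega] G -> (forall w, 0 <= G w) -> 0 <= c ->
  (forall A, measurable A ->
     \int[mu]_w (G w * \1_A (X w))%:E = c%:E * mu (X @^-1` A))%E ->
  measurable_fun [set: T] h -> (forall x, 0 <= h x) ->
  (\int[mu]_w (G w * h (X w))%:E = c%:E * \int[mu]_w (h (X w))%:E)%E.
Proof.
move=> mG G0 c0 GX mh h0.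
have mh' : measurable_fun [set: T] (EFin \o h) by exact/measurable_EFinP.
pose s := nnsfun_approx measurableT mh'.
have mX : measurable_fun [set: Omega] X by [].
have ms m : measurable_fun [set: Omega] (fun w => s m (X w)).
  by apply: measurableT_comp.
have s_cvg x : ((s m x)%:E @[m --> \oo] --> (h x)%:E)%E.
  by apply: (cvg_nnsfun_approx _ mh') => // y _; rewrite lee_fin.
have s_nd x a b : (a <= b)%N -> s a x <= s b x.
  by move=> ab; exact/lefP/nd_nnsfun_approx.
have s0 m x : 0 <= s m x by [].
have cvgG : (\int[mu]_w (G w * s m (X w))%:E @[m --> \oo] -->
    \int[mu]_w (G w * h (X w))%:E)%E.
  have -> : (\int[mu]_w (G w * h (X w))%:E =
      \int[mu]_w limn (fun m => (G w * s m (X w))%:E))%E.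
    apply: eq_integral => w _; apply/esym/cvg_lim => //.
    by under eq_fun do rewrite EFinM; rewrite EFinM; apply: cvgeZl.
  apply: cvg_monotone_convergence => //.
  - by move=> m; apply/measurable_EFinP; exact: measurable_funM.
  - by move=> m w _; rewrite lee_fin mulr_ge0.
  - by move=> w _ a b ab; rewrite lee_fin ler_wpM2l// s_nd.
have cvgh : (c%:E * \int[mu]_w (s m (X w))%:E @[m --> \oo] -->
    c%:E * \int[mu]_w (h (X w))%:E)%E.
  have -> : (\int[mu]_w (h (X w))%:E =
      \int[mu]_w limn (fun m => (s m (X w))%:E))%E.
    by apply: eq_integral => w _; apply/esym/cvg_lim.
  apply: cvgeZl => //; apply: cvg_monotone_convergence => //.
  - by move=> m; exact/measurable_EFinP.
  - by move=> m w _; rewrite lee_fin.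
  - by move=> w _ a b ab; rewrite lee_fin s_nd.
(* Both sides are limits of their values at [s m], so a simple function is enough; it is a finite
   combination of the indicators of its level sets. *)
suff s_int m : (\int[mu]_w (G w * s m (X w))%:E =
    c%:E * \int[mu]_w (s m (X w))%:E)%E.
  by move: cvgG; under eq_cvg do rewrite s_int; move=> /cvg_unique; apply.
pose g := s m.
have mI y :
    measurable_fun [set: Omega] (fun w => \1_(g @^-1` [set y]) (X w) : R).
  by apply: measurableT_comp.
have gE w : g (X w) = \sum_(y \in range g) y * \1_(g @^-1` [set y]) (X w).
  by rewrite fimfunE.
have rg0 y : y \in range g -> 0 <= y by rewrite inE => -[t _ <-].
have yI0 y x : 0 <= y * \1_(g @^-1` [set y]) x.
  exact: nnfun_muleindic_ge0.
transitivity (\sum_(y \in range g)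
    \int[mu]_w (y * (G w * \1_(g @^-1` [set y]) (X w)))%:E)%E.
  rewrite -ge0_integral_fsum//.
  - apply: eq_integral => w _; rewrite gE EFinM -fsumEFin//.
    rewrite ge0_mule_fsumr; last by move=> y; rewrite lee_fin.
    by apply: eq_fsbigr => y _; rewrite -EFinM mulrCA.
  - move=> y; apply/measurable_EFinP; apply: measurable_funM => //.
    exact: measurable_funM.
  - by move=> y w _; rewrite lee_fin mulrCA mulr_ge0.
transitivity (c%:E * \sum_(y \in range g)
    \int[mu]_w (y * \1_(g @^-1` [set y]) (X w))%:E)%E; last first.
  congr (_ * _)%E; rewrite -ge0_integral_fsum//.
  - by apply: eq_integral => w _; rewrite -/g gE -fsumEFin.
  - by move=> y; apply/measurable_EFinP; apply: measurable_funM.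
  - by move=> y w _; rewrite lee_fin.
rewrite ge0_mule_fsumr; last first.
  by move=> y; apply: integral_ge0 => w _; rewrite lee_fin.
apply: eq_fsbigr => y /rg0 y0.
under eq_integral do rewrite EFinM.
rewrite ge0_integralZl//; last 2 first.
- by apply/measurable_EFinP; apply: measurable_funM.
- by move=> w _; rewrite lee_fin mulr_ge0.
rewrite GX// muleCA; congr (_ * _)%E.
under [in RHS]eq_integral do rewrite EFinM.
rewrite ge0_integralZl//; last exact/measurable_EFinP.
congr (_ * _)%E.
rewrite (eq_integral (fun w => (\1_(X @^-1` (g @^-1` [set y])) w)%:E))//.
rewrite integral_indic//= ?setIT//.
rewrite -[X in measurable X]setTI; exact: mX.
Qed.

Section Independence.
Context (d d' : measure_display) (Omega : measurableType d)
  (T : measurableType d') (R : realType) (P : probability Omega R).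

(* The indicators in the definition of independence are replaced by the [h i]
   one coordinate at a time. *)
Lemma integral_prod_independent (n : nat) (Z : 'I_n -> {mfun Omega >-> T})
    (h : 'I_n -> T -> R) :
  mutually_independent P Z ->
  (forall i, measurable_fun [set: T] (h i)) -> (forall i x, 0 <= h i x) ->
  (forall i, \int[P]_w (h i (Z i w))%:E < +oo)%E ->
  (\int[P]_w (\prod_(i < n) h i (Z i w))%:E =
   \prod_(i < n) \int[P]_w (h i (Z i w))%:E)%E.
Proof.
move=> indep.
(* Induction on the number [m] of leading coordinates where [h] is arbitrary, the others carrying
   indicators. [m = 0] is independence with the full index set, [m = n] the claim. *)
suff main m : (m <= n)%N -> forall h : 'I_n -> T -> R,
    (forall i, measurable_fun [set: T] (h i)) -> (forall i x, 0 <= h i x) ->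
    (forall i, \int[P]_w (h i (Z i w))%:E < +oo)%E ->
    (forall i : 'I_n, (m <= i)%N -> exists2 A, measurable A & h i = \1_A) ->
  (\int[P]_w (\prod_(i < n) h i (Z i w))%:E =
   \prod_(i < n) \int[P]_w (h i (Z i w))%:E)%E.
  move=> mh h0 hoo; apply: (main n) => // i.
  by rewrite leqNgt ltn_ord.
elim: m => [_|m IH mn] {}h mh h0 hoo hI.
  have /choice [A /all_and2[mA hA]] :
      forall i, exists A, measurable A /\ h i = \1_A.
    by move=> i; have [A] := hI i isT; exists A.
  have mZ i : measurable (Z i @^-1` A i).
    by rewrite -[X in measurable X]setTI; apply: measurable_funPT.
  have := indep [set: 'I_n]%SET A mA.
  rewrite (eq_bigl predT) => [PE|i]; last by rewrite inE.
  transitivity (P (\bigcap_(i in [set` [set: 'I_n]%SET]) (Z i @^-1` A i))).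
    rewrite -[X in P X]setIT -integral_indic//; last first.
      by apply: fin_bigcap_measurable => //; apply: finite_finset.
    apply: eq_integral => w _; rewrite indicE; congr (_%:E).
    have [wA|] := boolP (w \in _).
      rewrite big1// => i _; rewrite hA indicE mem_set//.
      by move: wA; rewrite inE; apply; rewrite /= inE.
    move=> wA; have [i wi] : exists i, ~ A i (Z i w).
      apply/existsNP => h1; move/negP: wA; apply; rewrite inE => i _; exact: h1.
    by rewrite (bigD1 i)//= hA indicE memNset// mul0r.
  rewrite PE; apply: eq_bigr => i _.
  rewrite -[X in P X]setIT -integral_indic//.
  by apply: eq_integral => w _; rewrite hA.
pose j : 'I_n := Ordinal mn.
pose G w := \prod_(i < n | i != j) h i (Z i w).
pose c := fine (\prod_(i < n | i != j) \int[P]_w (h i (Z i w))%:E)%E.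
have int_ge0 i : (0 <= \int[P]_w (h i (Z i w))%:E)%E.
  by apply: integral_ge0 => w _; rewrite lee_fin.
have cE : (c%:E = \prod_(i < n | i != j) \int[P]_w (h i (Z i w))%:E)%E.
  rewrite fineK//; apply: (big_ind (fun x : \bar R => x \is a fin_num)) => //.
    by move=> x y; exact: fin_numM.
  move=> i _.
  by rewrite ge0_fin_numE.
transitivity (\int[P]_w (G w * h j (Z j w))%:E)%E.
  by apply: eq_integral => w _; rewrite (bigD1 j)//= mulrC.
rewrite (@integral_weighted_comp _ _ _ _ _ _ _ _ c)//.
- by rewrite [RHS](bigD1 j)//= muleC cE.
- have -> : G = fun w => \prod_(i < n) (if i != j then h i (Z i w) else 1).
    by apply/funext => w; rewrite /G big_mkcond.
  apply: measurable_prod => i _ /=; case: (i != j) => //.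
  by apply: measurableT_comp.
- by move=> w; apply: prodr_ge0.
- rewrite -lee_fin cE.
  apply: (big_ind (fun x : \bar R => 0 <= x)%E) => // x y.
  exact: mule_ge0.
- move=> A mA.
  (* With an indicator at coordinate [j], only the coordinates before [m] remain arbitrary, so the
     induction hypothesis applies to [h']. *)
  pose h' i := if i == j then \1_A else h i.
  have mZA : measurable (Z j @^-1` A).
    by rewrite -[X in measurable X]setTI; apply: measurable_funPT.
  have intA : (\int[P]_w (\1_A (Z j w))%:E = P (Z j @^-1` A))%E.
    by rewrite -[X in P X]setIT -integral_indic.
  transitivity (\int[P]_w (\prod_(i < n) h' i (Z i w))%:E)%E.
    apply: eq_integral => w _; rewrite (bigD1 j)//= /h' eqxx mulrC.
    by congr (_ * _)%:E; apply: eq_bigr => i /negbTE ->.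
  rewrite IH//.
  + rewrite (bigD1 j)//= {1}/h' eqxx intA muleC cE; congr (_ * _)%E.
    apply: eq_bigr => i /negbTE ij; apply: eq_integral => w _.
    by rewrite /h' ij.
  + exact: ltnW.
  + by move=> i; rewrite /h'; case: ifPn.
  + by move=> i x; rewrite /h'; case: ifPn.
  + move=> i; rewrite /h'; case: ifPn => // /eqP ->.
    by rewrite intA (le_lt_trans (probability_le1 _ _))// ltry.
  + move=> i mi; rewrite /h'; case: ifPn => [_|ij]; first by exists A.
    apply: hI; rewrite ltn_neqAle mi andbT.
    by apply: contra ij => /eqP im; apply/eqP/val_inj.
Qed.

Lemma ge0_integral_iid (n : nat) (Z0 : {mfun Omega >-> T})
    (Z : 'I_n -> {mfun Omega >-> T}) (h : T -> R) (i : 'I_n) :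
  iid_copies P Z0 Z -> measurable_fun [set: T] h -> (forall x, 0 <= h x) ->
  (\int[P]_w (h (Z i w))%:E = \int[P]_w (h (Z0 w))%:E)%E.
Proof.
move=> [_ hd] mh h0.
have mh' : measurable_fun [set: T] (EFin \o h) by exact/measurable_EFinP.
have h0' x : (0 <= (EFin \o h) x)%E by rewrite /= lee_fin.
rewrite -(ge0_integral_distribution (Z i) mh' h0').
rewrite -(ge0_integral_distribution Z0 mh' h0').
by apply: eq_measure_integral => A mA _; exact: hd.
Qed.

(* Markov's inequality for [\prod_i g (Z i)], of mean
   [(E g)^n <= (1 + a)^n <= expR (n a)]. *)
Lemma log_deviation (n : nat) (Z0 : {mfun Omega >-> T})
    (Z : 'I_n -> {mfun Omega >-> T}) (g : T -> R) (a delta : R) :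
  iid_copies P Z0 Z -> measurable_fun [set: T] g -> (forall x, 0 < g x) ->
  (\int[P]_w (g (Z0 w))%:E <= (1 + a)%:E)%E -> 0 < delta ->
  exists E, [/\ measurable E, (P (~` E) <= delta%:E)%E &
    forall w, E w -> \sum_(i < n) ln (g (Z i w)) <= n%:R * a + ln delta^-1].
Proof.
move=> hiid mg g0 ga delta0.
have g0' x : 0 <= g x by exact: ltW.
pose Y w := \prod_(i < n) g (Z i w).
(* At level [M], Markov's inequality gives failure probability at most [delta], and [ln M] is the
   announced bound. *)
pose M := expR (n%:R * a) / delta.
have M0 : 0 < M by rewrite divr_gt0// expR_gt0.
have mY : measurable_fun [set: Omega] Y.
  by apply: measurable_prod => i _; apply: measurableT_comp.
have Y0 w : 0 < Y w by exact: prodr_gt0.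
have intY : (\int[P]_w (Y w)%:E <= (expR (n%:R * a))%:E)%E.
  rewrite /Y (integral_prod_independent (h := fun=> g)) => [| |//|//|i].
  - under eq_bigr do rewrite (ge0_integral_iid _ hiid)//.
    have i0 : (0 <= \int[P]_w (g (Z0 w))%:E)%E.
      by apply: integral_ge0 => w _; rewrite lee_fin.
    (* [a] may be negative; raising [1 + a <= expR a] to the power [n] requires [0 <= 1 + a]. *)
    have a0 : 0 <= 1 + a by rewrite -lee_fin (le_trans i0).
    have /andP[_ /le_trans ->//] :
        (0 <= \prod_(i < n) \int[P]_w (g (Z0 w))%:E <=
         \prod_(i < n) (1 + a)%:E)%E.
      elim/big_rec2 : _ => [|i x y _ /andP[x0 xy]]; first by rewrite lee01 lexx.
      by rewrite mule_ge0// lee_pmul.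
    rewrite -(big_morph EFin EFinM (erefl 1%:E)) lee_fin prodr_const card_ord.
    rewrite expRM_natl.
    by rewrite lerXn2r ?nnegrE ?expR_ge0// expR_ge1Dx.
  - by case: hiid.
  - by rewrite (ge0_integral_iid _ hiid)// (le_lt_trans ga)// ltry.
have mE : measurable [set w | Y w <= M].
  by rewrite -[X in measurable X]setTI; apply: measurable_fun_le.
exists [set w | Y w <= M]; split => //.
- have mE' := measurableC mE.
  rewrite -(@lee_pmul2l _ M%:E) ?lte_fin//.
  have -> : (M%:E * delta%:E = (expR (n%:R * a))%:E)%E.
    by rewrite -EFinM divfK// gt_eqF.
  apply: le_trans intY.
  rewrite -[X in P X]setIT -integral_indic//.
  rewrite -ge0_integralZl ?lee_fin ?(ltW M0)//; last first.
    by apply/measurable_EFinP.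
  apply: ge0_le_integral => //.
  + by move=> w _; rewrite -EFinM lee_fin mulr_ge0// ltW.
  + by apply/measurable_EFinP; apply: measurable_funM.
  + by apply/measurable_EFinP.
  + move=> w _; rewrite -EFinM lee_fin indicE.
    have [|_] := boolP (w \in _); last by rewrite mulr0 ltW.
    by rewrite inE /= mulr1 => /negP; rewrite -ltNge => /ltW.
- move=> w /= YM.
  have -> : \sum_(i < n) ln (g (Z i w)) = ln (Y w).
    rewrite /Y; apply/esym.
    suff [] : 0 < \prod_(i < n) g (Z i w) /\
      ln (\prod_(i < n) g (Z i w)) = \sum_(i < n) ln (g (Z i w)) by [].
    elim/big_rec2 : _ => [|i x y _ [y0 xy]]; first by rewrite ln1.
    by rewrite mulr_gt0// lnM ?posrE// xy.
  rewrite -[X in X + _](expRK (n%:R * a)) -lnM ?posrE ?expR_gt0 ?invr_gt0//.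
  by rewrite ler_ln ?posrE.
Qed.

End Independence.

(** * The Euclidean norm and finite nets of bounded sets *)

Section EuclideanNorm.
Context (R : realType) (p : nat).
Implicit Types (x y : 'rV[R]_p) (A : set 'rV[R]_p).

Lemma norm2_ge0 x : 0 <= norm2 x.
Proof. exact: sqrtr_ge0. Qed.

Lemma sqr_norm2 x : norm2 x ^+ 2 = \sum_(j < p) x ord0 j ^+ 2.
Proof. by rewrite sqr_sqrtr// sumr_ge0// => i _; exact: sqr_ge0. Qed.

Lemma norm2N x : norm2 (- x) = norm2 x.
Proof. by rewrite /norm2; under eq_bigr do rewrite mxE sqrrN. Qed.

Lemma ler_coord_norm2 x j : `|x ord0 j| <= norm2 x.
Proof.
rewrite -(@ler_pXn2r _ 2) ?nnegrE ?norm2_ge0// sqr_norm2 real_normK ?num_real//.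
by rewrite (bigD1 j)//= lerDl sumr_ge0// => i _; exact: sqr_ge0.
Qed.

(** The crude factor [p.+1], instead of the square root of [p], stays positive when [p = 0], so that
    it can be divided by. *)
Lemma norm2_le_norm x : norm2 x <= p.+1%:R * `|x|.
Proof.
rewrite -(@ler_pXn2r _ 2) ?nnegrE ?norm2_ge0 ?mulr_ge0// sqr_norm2.
apply: (@le_trans _ _ (\sum_(j < p) `|x| ^+ 2)).
  apply: ler_sum => j _; rewrite -[leLHS]real_normK ?num_real//.
  rewrite ler_pXn2r ?nnegrE//.
  rewrite [leRHS]/Num.norm /= mx_normrE.
  by apply: (le_bigmax_cond _ (fun ij : 'I_1 * 'I_p => `|x ij.1 ij.2|)
    (j := (ord0, j))).
rewrite sumr_const card_ord -[leLHS]mulr_natl exprMn ler_wpM2r ?sqr_ge0//.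
by rewrite -natrX ler_nat expnS expn1 (leq_trans (leqnSn p))// leq_pmulr.
Qed.

(** The closure of [A] lies in a cube, hence is compact, and is covered by the open sup-norm balls
    of radius [e'] centered in [A]. The scaling of [e'] puts each of them inside a Euclidean ball of
    radius [e]. *)
Lemma covered_by_bounded A (r e : R) :
  (forall x, A x -> norm2 x <= r) -> 0 < e -> exists k, covered_by A e k.
Proof.
move=> Ar e0; pose e' := e / p.+1%:R.
have e'0 : 0 < e' by rewrite divr_gt0// ltr0n.
have : compact (closure A).
  pose K := [set v : 'rV[R]_p | forall i, `[- r, r]%classic (v ord0 i)].
  have cK : compact K.
    apply: (@rV_compact _ _ (fun=> `[- r, r]%classic)) => _.
    exact: segment_compact.
  apply: (subclosed_compact _ cK); first exact: closed_closure.
  have /closure_id -> : closed K.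
    by apply: compact_closed cK; exact: norm_hausdorff.
  apply: closure_subset => x Ax i /=.
  by rewrite in_itv /= -ler_norml (le_trans (ler_coord_norm2 _ _))// Ar.
rewrite compact_cover => /(_ _ A (fun c => ball c e')) [].
- by move=> c _; exact: ball_open.
- move=> x /(_ (ball x e')) []; first exact: nbhsx_ballx.
  by move=> c [Ac xc]; exists c => //; exact: ball_sym.
move=> D DA AD; have /finite_seqP[s Ds] := finite_fset D.
exists (size s), (fun i => nth 0 s i); split => [i|x Ax].
  have : [set` s] (nth 0 s i) by exact: mem_nth.
  by rewrite -Ds => /DA /set_mem.
have [c /= cD xc] := AD _ (subset_closure Ax).
have cs : c \in s by have : [set` s] c by rewrite -Ds.
have ci : (index c s < size s)%N by rewrite index_mem.
exists (Ordinal ci) => /=; rewrite nth_index// (le_trans (norm2_le_norm _))//.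
rewrite -ler_pdivlMl ?ltr0n// mulrC ltW//.
by move: xc; rewrite -ball_normE /= distrC.
Qed.

Lemma covered_by_covering_number A (r e : R) :
  (forall x, A x -> norm2 x <= r) -> 0 < e ->
  covered_by A e (covering_number A e).
Proof.
move=> Ar e0; rewrite /covering_number.
case: xgetP => [k _ []//|nocov].
have : exists k, `[< covered_by A e k >].
  by have [k ck] := covered_by_bounded Ar e0; exists k; apply/asboolP.
move=> /ex_minnP[k /asboolP ck kmin]; exfalso; apply: (nocov k).
by split => // j cj; apply: kmin; exact/asboolP.
Qed.

End EuclideanNorm.

(** * Consequences of the growth condition *)

Section Growth.
Context (R : realType) (lambda f : R -> R) (c2 : R).
Hypothesis hC1 : growth_condition lambda f c2.

Lemma growth_ge0 (x : R) : 0 <= x -> 0 <= lambda x.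
Proof. by case: hC1 => -[l0 _ _ _] _; exact: l0. Qed.

Lemma growth_le (x y : R) : 0 <= x -> x <= y -> lambda x <= lambda y.
Proof.
case: hC1 => -[_ _ hl _] _ x0 xy; apply: hl => //; rewrite in_itv/= andbT//.
exact: le_trans xy.
Qed.

(** For [0 < t < 1], [lambda 0 <= lambda t <= f t * lambda 1], and [f t <= f t / t] is arbitrarily
    small for small [t]. *)
Lemma growth0 : lambda 0 = 0.
Proof.
case: (hC1) => _ [_ f0 hf ft _].
apply/eqP; rewrite eq_le growth_ge0// andbT; apply/ler_addgt0Pr => e e0.
rewrite add0r.
have l1 : 0 <= lambda 1 by rewrite growth_ge0.
pose e' := e / (lambda 1 + 1).
have e'0 : 0 < e' by rewrite divr_gt0// ltr_wpDl.
have [t [t0 t1 fte]] : exists t, [/\ 0 < t, t < 1 & f t / t < e'].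
  have : \forall t \near 0^'+, [/\ 0 < t, t < 1 & f t / t < e'].
    near=> t; split; [by []|by near: t; exact: nbhs_right_lt|].
    rewrite -[X in X < _]subr0 (le_lt_trans (ler_norm _))//.
    near: t; have /cvgrPdist_lt /(_ _ e'0) := ft.
    by apply: filterS => t; rewrite distrC.
  by move=> /filter_ex.
apply: (@le_trans _ _ (lambda (t * 1))); first by rewrite growth_le// mulr1 ltW.
apply: (le_trans (hf _ _ t0 ltr01)).
apply: (@le_trans _ _ (e' * lambda 1)).
  rewrite ler_wpM2r// (le_trans _ (ltW fte))// ler_pdivlMr//.
  by rewrite ler_piMr ?f0// ltW.
rewrite /e' mulrAC ler_pdivrMr ?ltr_wpDl//.
by rewrite ler_wpM2l ?lerDl// ltW.
Unshelve. all: by end_near. Qed.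

Lemma growthM (t x : R) : 0 < t -> 0 <= x -> lambda (t * x) <= f t * lambda x.
Proof.
case: (hC1) => _ [_ _ hf _ _] t0.
by rewrite le_eqVlt => /predU1P[<-|x0]; [rewrite mulr0 growth0 mulr0|exact: hf].
Qed.

(** [lambda x / x] tends to infinity, so [x <= lambda x] beyond some point. This makes a variable
    integrable as soon as [lambda] of its absolute value is. *)
Lemma growth_superlinear :
  exists2 K : R, 0 <= K & forall x, 0 <= x -> x <= K + lambda x.
Proof.
case: (hC1) => -[_ _ _ +] _ => /cvgryPge/(_ 1)[K [_ hK]].
exists (Num.max K 0); first by rewrite le_max lexx orbT.
move=> x x0; have [xK|Kx] := leP x (Num.max K 0).
  by rewrite (le_trans xK)// lerDl growth_ge0.
move: Kx; rewrite gt_max => /andP[Kx x0'].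
have := hK x Kx; rewrite /= ler_pdivlMr// mul1r => /le_trans; apply.
by rewrite lerDr le_max lexx orbT.
Qed.

Lemma growth_measurable d (T : measurableType d) (h : T -> R) :
  measurable_fun [set: T] h -> (forall z, 0 <= h z) ->
  measurable_fun [set: T] (fun z => lambda (h z)).
Proof.
move=> mh h0.
(* [lambda] is monotone on the half-line only; truncating its argument at 0 gives a function
   monotone, hence measurable, on the whole line. *)
have -> : (fun z => lambda (h z)) = (fun x => lambda (Num.max x 0)) \o h.
  by apply/funext => z /=; rewrite max_l.
apply: measurableT_comp => //; apply: nondecreasing_measurable => // x y xy.
apply: growth_le; first by rewrite le_max lexx orbT.
by rewrite ge_max !le_max xy lexx orbT.
Qed.

End Growth.

(** * Means, integrability and probability estimates *)

Section Mean.
Context (d : measure_display) (Omega : measurableType d) (R : realType)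
  (P : probability Omega R).
Implicit Types X Y : Omega -> R.

Local Notation integrable X := (P.-integrable [set: Omega] (EFin \o X)).
Local Notation mean X := (Rintegral P [set: Omega] X).

(** Integrability and mean come together, so that linear combinations can be built one term at a
    time. *)
Lemma integrableDZ (a : R) X Y : integrable X -> integrable Y ->
  integrable (fun w => X w + a * Y w) /\
  mean (fun w => X w + a * Y w) = mean X + a * mean Y.
Proof.
move=> iX iY.
have iaY : integrable (fun w => a * Y w).
  by apply: eq_integrable (integrableZl measurableT a iY).
split; first by apply: eq_integrable (integrableD measurableT iX iaY).
by rewrite RintegralD// RintegralZl.
Qed.

Lemma integrable_const (a : R) : integrable (fun=> a) /\ mean (fun=> a) = a.
Proof.
split; first exact: finite_measure_integrable_cst.
rewrite Rintegral_cst//= probability_setT mulr1//.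
Qed.

Lemma integral_mean X : integrable X -> (\int[P]_w (X w)%:E = (mean X)%:E)%E.
Proof. by move=> iX; rewrite /Rintegral fineK// integrable_fin_num. Qed.

Lemma growth_integrable (lambda f : R -> R) (c2 : R) X :
  growth_condition lambda f c2 -> measurable_fun [set: Omega] X ->
  (\int[P]_w (lambda `|X w|)%:E < +oo)%E ->
  integrable X /\ integrable (fun w => lambda `|X w|).
Proof.
move=> hC1 mX Xoo.
have mlX : measurable_fun [set: Omega] (fun w => lambda `|X w|).
  by apply: (growth_measurable hC1) => //; exact: measurableT_comp.
have ilX : integrable (fun w => lambda `|X w|).
  apply/integrableP; split; first exact/measurable_EFinP.
  rewrite (eq_integral (fun w => (lambda `|X w|)%:E))// => w _ /=.
  by rewrite ger0_norm// (growth_ge0 hC1).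
split => //; have [K K0 hK] := growth_superlinear hC1.
have [iK _] := integrable_const K.
have [iKl _] := integrableDZ 1 iK ilX.
apply: le_integrable iKl => //; first exact/measurable_EFinP.
move=> w _ /=; rewrite lee_fin mul1r.
by rewrite [leRHS]ger0_norm ?hK// addr_ge0// (growth_ge0 hC1).
Qed.

Lemma prob_bigsetU_le (I : finType) (F : I -> set Omega) (e : R) :
  (forall i, measurable (F i)) -> (forall i, P (F i) <= e%:E)%E ->
  (P (\big[setU/set0]_i F i) <= (#|I|%:R * e)%:E)%E.
Proof.
move=> mF Fe.
apply: (@le_trans _ _ (\sum_(i : I) e%:E)%E); last first.
  by rewrite sumEFin lee_fin sumr_const mulr_natl.
suff [] : measurable (\big[setU/set0]_i F i) /\
    (P (\big[setU/set0]_i F i) <= \sum_(i : I) e%:E)%E by [].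
apply: (big_rec2 (fun A (x : \bar R) => measurable A /\ (P A <= x)%E)).
  by rewrite measure0.
move=> i A x _ [mA Ax].
split; first exact: measurableU.
apply: (le_trans (measureU2 _ _ _)) => //.
by apply: (@leeD R (P (F i)) _ (P A)); [exact: Fe|exact: Ax].
Qed.

Lemma prob_setC_le (A : set Omega) (e : R) : measurable A ->
  (P (~` A) <= e%:E)%E -> ((1 - e)%:E <= P A)%E.
Proof.
move=> mA; rewrite probability_setC// EFinB.
rewrite leeBlDr ?fin_num_measure// => h.
by rewrite leeBlDr// addeC.
Qed.

(** Continuity of [P] along the decreasing events [F j]. It serves to reach an infimum that may not
    be attained. *)
Lemma prob_le_right_limit X (q c : R) :
  (forall t : R, measurable [set w | X w <= t]) ->
  (forall t : R, (c < t)%R -> q%:E <= P [set w | (X w <= t)%R])%E ->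
  (q%:E <= P [set w | (X w <= c)%R])%E.
Proof.
move=> mX hX.
pose F (j : nat) := [set w | X w <= c + j.+1%:R^-1].
have FE : [set w | X w <= c] = \bigcap_j F j.
  apply/seteqP; split => w /=.
    by move=> Xc j _; rewrite /F /= (le_trans Xc)// lerDl invr_ge0.
  move=> Fw; apply/ler_addgt0Pr => e e0.
  (* This index [j] satisfies [e^-1 < j.+1], so the excess [j.+1%:R^-1] is below [e]. *)
  have := Fw (Num.truncn e^-1) I; rewrite /F /= => /le_trans; apply.
  rewrite lerD2l -[leRHS]invrK lef_pV2 ?posrE ?invr_gt0 ?ltr0n//.
  by rewrite ltW// truncnS_gt.
have mF j : measurable (F j) by exact: mX.
have cvgF : P \o F @ \oo --> P (\bigcap_j F j).
  apply: nonincreasing_cvg_mu => //.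
  - by rewrite (le_lt_trans (probability_le1 _ _))// ltry.
  - by rewrite -FE.
  - move=> i j ij; apply/subsetPset => w /= /le_trans; apply.
    by rewrite lerD2l lef_pV2 ?posrE ?ltr0n// ler_nat.
rewrite FE; apply: (cvge_to_ge cvgF).
by apply: nearW => j; apply: hX; rewrite ltrDl invr_gt0.
Qed.

End Mean.

(** * Deviation bounds for the empirical risk *)

Section RobustRiskMinimization.
Context (R : realType) (d : measure_display)
  (Omega : measurableType d) (P : probability Omega R) (k p n : nat)
  (Z0 : {mfun Omega >-> (borelRV R k * R)%type})
  (Z : 'I_n -> {mfun Omega >-> (borelRV R k * R)%type})
  (Theta : set 'rV[R]_p) (l : R -> 'rV[R]_k -> 'rV[R]_p -> R)
  (lambda f : R -> R) (c2 r : R) (H : R -> 'rV[R]_k -> R)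
  (psi : R -> R) (alpha : R).
Hypotheses (hn : (0 < n)%N) (hiid : iid_copies P Z0 Z)
  (hl : forall theta, Theta theta ->
     measurable_fun [set: (borelRV R k * R)%type] (loss_at l theta))
  (hC1 : growth_condition lambda f c2)
  (hr : forall theta, Theta theta -> norm2 theta <= r)
  (hH : measurable_fun [set: (borelRV R k * R)%type]
          (fun z : borelRV R k * R => H z.2 z.1))
  (hH0 : forall y x, 0 <= H y x)
  (hC3 : forall y x theta1 theta2, Theta theta1 -> Theta theta2 ->
     `|l y x theta2 - l y x theta1| <= H y x * norm2 (theta2 - theta1))
  (hC4 : ('E_P[fun w => lambda (H (Z0 w).2 (Z0 w).1)] < +oo)%E)
  (hC5 : (sup_lrisk P Z0 l lambda Theta < +oo)%E)
  (hpsi : truncation_function lambda psi) (halpha : 0 < alpha).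

Local Notation integrable X := (P.-integrable [set: Omega] (EFin \o X)).
Local Notation mean X := (Rintegral P [set: Omega] X).

(** Real versions of the extended-real risks and expectations. They agree with them, on [Theta] for
    [r_] and for nonempty [Theta] for [rl], so that the estimates become real arithmetic. *)
Let lossZ0 theta w := loss_at l theta (Z0 w).
Let HZ0 w := H (Z0 w).2 (Z0 w).1.
Let r_ theta := mean (lossZ0 theta).
Let mH := mean HZ0.
Let mlH := mean (fun w => lambda (HZ0 w)).
Let rl := fine (sup_lrisk P Z0 l lambda Theta).

Let lambda0 : forall x : R, 0 <= x -> 0 <= lambda x := growth_ge0 hC1.

Let f0 t : 0 < t -> 0 <= f t.
Proof. by case: hC1 => _ [_ h _ _ _]; exact: h. Qed.

Let c20 : 0 < c2.
Proof. by case: hC1 => _ []. Qed.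

Lemma lrisk_lty theta : Theta theta ->
  (lrisk P Z0 l lambda theta < +oo)%E.
Proof.
by move=> Th; apply: le_lt_trans hC5; apply: ereal_sup_ubound; exists theta.
Qed.

Lemma loss_integrable theta : Theta theta ->
  integrable (lossZ0 theta) /\ integrable (fun w => lambda `|lossZ0 theta w|).
Proof.
move=> Th; apply: (growth_integrable hC1).
  by apply: measurableT_comp => //; exact: hl.
by have := lrisk_lty Th; rewrite /lrisk unlock.
Qed.

Lemma H_integrable : integrable HZ0 /\ integrable (fun w => lambda (HZ0 w)).
Proof.
have HE w : `|HZ0 w| = HZ0 w by rewrite ger0_norm// hH0.
have [iH ilH] : integrable HZ0 /\ integrable (fun w => lambda `|HZ0 w|).
  apply: (growth_integrable hC1); first exact: measurableT_comp hH _.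
  by under eq_integral do rewrite HE; move: hC4; rewrite unlock.
by split => //; apply: eq_integrable ilH => // w _ /=; rewrite HE.
Qed.

Lemma riskE theta : Theta theta -> risk P Z0 l theta = (r_ theta)%:E.
Proof.
by move=> /loss_integrable[il _]; rewrite /risk unlock integral_mean.
Qed.

(** Nonemptiness matters: the supremum over the empty set is [-oo], which [fine] sends to 0. *)
Lemma sup_lriskE : Theta !=set0 -> sup_lrisk P Z0 l lambda Theta = rl%:E.
Proof.
move=> [theta Th]; rewrite /rl fineK// ge0_fin_numE//.
apply: (@le_trans _ _ (lrisk P Z0 l lambda theta)).
  by rewrite /lrisk expectation_ge0// => w; rewrite lambda0.
by apply: ereal_sup_ubound; exists theta.
Qed.

Lemma mean_lambda_le theta : Theta theta ->
  mean (fun w => lambda `|lossZ0 theta w|) <= rl.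
Proof.
move=> Th; have [_ il] := loss_integrable Th.
rewrite -lee_fin -sup_lriskE; last by exists theta.
rewrite -integral_mean//; apply: ereal_sup_ubound; exists theta => //.
by rewrite /lrisk unlock.
Qed.

Lemma expected_H : 'E_P[HZ0]%E = mH%:E.
Proof. by rewrite unlock integral_mean//; case: H_integrable. Qed.

Lemma expected_lambda_H : 'E_P[fun w => lambda (HZ0 w)]%E = mlH%:E.
Proof. by rewrite unlock integral_mean//; case: H_integrable. Qed.

Lemma mH_ge0 : 0 <= mH.
Proof. by apply: Rintegral_ge0 => w _; exact: hH0. Qed.

Lemma risk_lipschitz theta1 theta2 : Theta theta1 -> Theta theta2 ->
  r_ theta2 <= r_ theta1 + norm2 (theta2 - theta1) * mH.
Proof.
move=> T1 T2; have [i1 _] := loss_integrable T1.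
have [i2 _] := loss_integrable T2; have [iH _] := H_integrable.
have [i3 <-] := integrableDZ (norm2 (theta2 - theta1)) i1 iH.
apply: le_Rintegral => // w _.
rewrite -lerBlDl mulrC; apply: le_trans (hC3 _ _ T1 T2).
exact: ler_norm.
Qed.

(** The scaling inequality [lambda (alpha * x) <= f alpha * lambda x] produces the term
    [f alpha * rl] in the mean of [g]. *)
Lemma upper_deviation theta delta : Theta theta -> 0 < delta ->
  exists E, [/\ measurable E, (P (~` E) <= delta%:E)%E &
    forall w, E w -> \sum_(i < n) psi (alpha * loss_at l theta (Z i w)) <=
      n%:R * (alpha * r_ theta + f alpha * rl) + ln delta^-1].
Proof.
move=> Th delta0; have [il ill] := loss_integrable Th.
pose x z := alpha * loss_at l theta z.
pose g z := 1 + x z + lambda `|x z|.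
have g0 z : 0 < g z by have [_ h] := hpsi; have [] := h (x z).
have mx : measurable_fun [set: (borelRV R k * R)%type] x.
  by apply: measurable_funM => //; exact: hl.
have mg : measurable_fun [set: (borelRV R k * R)%type] g.
  apply: measurable_funD; first exact: measurable_funD.
  by apply: (growth_measurable hC1) => //; exact: measurableT_comp.
have [i1 m1] := integrable_const P 1.
have [i2 m2] := integrableDZ alpha i1 il.
have [i3 m3] := integrableDZ (f alpha) i2 ill.
have Eg : (\int[P]_w (g (Z0 w))%:E <=
    (1 + (alpha * r_ theta + f alpha * rl))%:E)%E.
  apply: (@le_trans _ _ (mean (fun w => 1 + alpha * lossZ0 theta w +
      f alpha * lambda `|lossZ0 theta w|))%:E).
    rewrite -integral_mean//; apply: ge0_le_integral => //.
    - by move=> w _; rewrite lee_fin ltW.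
    - by apply/measurable_EFinP; exact: measurableT_comp mg _.
    - by case/integrableP: i3.
    - move=> w _; rewrite lee_fin lerD2l normrM gtr0_norm//.
      exact: growthM hC1 _ _ _ _.
  rewrite m3 m2 m1 lee_fin -addrA !lerD2l ler_wpM2l ?f0//.
  exact: mean_lambda_le.
have [E [mE PE hE]] := log_deviation hiid mg g0 Eg delta0.
exists E; split => // w /hE; apply: le_trans.
apply: ler_sum => i _; have [_ h] := hpsi.
by have [] := h (x (Z i w)).
Qed.

(** One event serves the whole ball, since [g] depends only on [c] and [H]. The factors [c2] come
    from splitting [lambda] of a sum. The factor 2 before [alpha * kappa] reflects two uses of the
    Lipschitz bound: inside [psi], and between the risks of [c] and [theta]. *)
Lemma lower_deviation c kappa delta : Theta c -> 0 < kappa -> 0 < delta ->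
  exists E, [/\ measurable E, (P (~` E) <= delta%:E)%E &
    forall w theta, E w -> Theta theta -> norm2 (theta - c) <= kappa ->
      n%:R * (alpha * r_ theta - 2 * (alpha * kappa) * mH
        - c2 * f alpha * rl - c2 * f (alpha * kappa) * mlH) - ln delta^-1 <=
      \sum_(i < n) psi (alpha * loss_at l theta (Z i w))].
Proof.
move=> Tc kappa0 delta0; have [il ill] := loss_integrable Tc.
have [iH ilH] := H_integrable.
have ak0 : 0 < alpha * kappa by rewrite mulr_gt0.
pose x z := alpha * loss_at l c z - alpha * kappa * H z.2 z.1.
pose g z := 1 - x z + lambda `|x z|.
have g0 z : 0 < g z by have [_ h] := hpsi; have [] := h (x z).
have mx : measurable_fun [set: (borelRV R k * R)%type] x.
  by apply: measurable_funB; apply: measurable_funM => //; exact: hl.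
have mg : measurable_fun [set: (borelRV R k * R)%type] g.
  apply: measurable_funD; first exact: measurable_funB.
  by apply: (growth_measurable hC1) => //; exact: measurableT_comp.
pose a := - alpha * r_ c + alpha * kappa * mH + c2 * f alpha * rl
  + c2 * f (alpha * kappa) * mlH.
have [i1 m1] := integrable_const P 1.
have [i2 m2] := integrableDZ (- alpha) i1 il.
have [i3 m3] := integrableDZ (alpha * kappa) i2 iH.
have [i4 m4] := integrableDZ (c2 * f alpha) i3 ill.
have [i5 m5] := integrableDZ (c2 * f (alpha * kappa)) i4 ilH.
have Eg : (\int[P]_w (g (Z0 w))%:E <= (1 + a)%:E)%E.
  apply: (@le_trans _ _ (mean (fun w => 1 + - alpha * lossZ0 c w
      + alpha * kappa * HZ0 w + c2 * f alpha * lambda `|lossZ0 c w|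
      + c2 * f (alpha * kappa) * lambda (HZ0 w)))%:E).
    rewrite -integral_mean//; apply: ge0_le_integral => //.
    - by move=> w _; rewrite lee_fin ltW.
    - by apply/measurable_EFinP; exact: measurableT_comp mg _.
    - by case/integrableP: i5.
    - move=> w _; rewrite lee_fin /g /x -/(HZ0 w) -/(lossZ0 c w).
      rewrite [leRHS](_ : _ = 1 - (alpha * lossZ0 c w - alpha * kappa * HZ0 w)
        + c2 * (f alpha * lambda `|lossZ0 c w|
          + f (alpha * kappa) * lambda (HZ0 w))); last by ring.
      rewrite lerD2l.
      have H0 : 0 <= HZ0 w by exact: hH0.
      have b0 : 0 <= alpha * kappa * HZ0 w by rewrite mulr_ge0// ltW.
      apply: (@le_trans _ _ (lambda (alpha * `|lossZ0 c w|
          + alpha * kappa * HZ0 w))).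
        apply: (growth_le hC1) => //; apply: le_trans (ler_normB _ _) _.
        by rewrite normrM gtr0_norm// (ger0_norm b0).
      have [_ [_ _ _ _ hsub]] := hC1.
      apply: le_trans (hsub _ _ _ b0) _; first by rewrite mulr_ge0// ltW.
      rewrite ler_pM2l// lerD// (growthM hC1)//.
  rewrite m5 m4 m3 m2 m1 lee_fin /a.
  have : c2 * f alpha * mean (fun w => lambda `|lossZ0 c w|) <=
      c2 * f alpha * rl.
    by rewrite ler_wpM2l ?mean_lambda_le// mulr_ge0 ?f0// ltW.
  by rewrite /r_ /mH /mlH; lra.
have [E [mE PE hE]] := log_deviation hiid mg g0 Eg delta0.
exists E; split => // w theta /hE {}hE Tt tc.
have [psi_nd hp] := hpsi.
apply: (@le_trans _ _ (- (\sum_(i < n) ln (g (Z i w))))); last first.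
  rewrite -sumrN; apply: ler_sum => i _.
  apply: (@le_trans _ _ (psi (x (Z i w)))); first by have [] := hp (x (Z i w)).
  apply: psi_nd; rewrite /x -mulrA -mulrBr ler_pM2l// lerBlDr.
  rewrite -lerBlDl; have := hC3 (Z i w).2 (Z i w).1 Tt Tc.
  move=> /(le_trans (ler_norm _)) /le_trans; apply.
  by rewrite mulrC ler_wpM2r// -norm2N opprB.
apply: (@le_trans _ _ (- (n%:R * a + ln delta^-1))); last by rewrite lerN2.
rewrite opprD lerD2r -[leRHS]mulrN ler_wpM2l// /a.
(* Second use of the Lipschitz bound, replacing [r_ c] by [r_ theta]. *)
have := risk_lipschitz Tc Tt.
have : norm2 (theta - c) * mH <= kappa * mH by rewrite ler_wpM2r// mH_ge0.
move=> h1 h2; have h3 := le_trans h2 (lerD (lexx _) h1).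
have : alpha * r_ theta <= alpha * (r_ c + kappa * mH) by rewrite ler_pM2l.
lra.
Qed.

Lemma uniform_lower_deviation kappa delta N :
  covered_by Theta kappa N -> (0 < N)%N -> 0 < kappa -> 0 < delta ->
  exists E, [/\ measurable E, (P (~` E) <= delta%:E)%E &
    forall w theta, E w -> Theta theta ->
      n%:R * (alpha * r_ theta - 2 * (alpha * kappa) * mH
        - c2 * f alpha * rl - c2 * f (alpha * kappa) * mlH)
        - ln (N%:R / delta) <=
      \sum_(i < n) psi (alpha * loss_at l theta (Z i w))].
Proof.
move=> [c [cT ccov]] N0 kappa0 delta0.
(* Each of the [N] centers is allotted failure probability [delta / N], which turns [ln delta^-1]
   into [ln (N%:R / delta)]. *)
have dN0 : 0 < delta / N%:R by rewrite divr_gt0// ltr0n.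
have /choice[E hE] i := lower_deviation (cT i) kappa0 dN0.
exists (~` \big[setU/set0]_i ~` E i); split.
- apply: measurableC; apply: bigsetU_measurable => i _; apply: measurableC.
  by have [] := hE i.
- rewrite setCK; apply: (le_trans (prob_bigsetU_le _ (e := delta / N%:R) _)).
  + by move=> i; apply: measurableC; have [] := hE i.
  + by move=> i; have [] := hE i.
  + by rewrite card_ord mulrC divfK// pnatr_eq0 -lt0n.
- move=> w theta /= Ew Tt; have [i tc] := ccov _ Tt.
  have Eiw : E i w.
    by apply: contrapT => nE; apply: Ew; rewrite (bigD1 i)//=; left.
  have [_ _ /(_ w theta Eiw Tt tc)] := hE i.
  by rewrite invf_div.
Qed.

(** * Excess risk of the penalized estimator *)

Section Estimator.
Context (rho delta : R) (thetahat : {mfun Omega >-> borelRV R p}).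
Hypotheses (hrho : 0 < rho) (hdelta : 0 < delta)
  (hthetahat : forall w, argmin Theta
     (fun theta => emp_risk Z l psi alpha w theta + rho * norm2 theta ^+ 2)
     (thetahat w)).

Let hatT w : Theta (thetahat w).
Proof. by have [] := hthetahat w. Qed.

(** Each deviation bound fails with probability at most [delta]. The upper one contributes
    [f alpha * rl] and [ln delta^-1], the lower one [c2 * f alpha * rl] and [ln (N%:R / delta)];
    hence [c2 + 1] and [delta ^+ 2]. *)
Lemma oracle_inequality theta0 kappa N :
  Theta theta0 -> covered_by Theta kappa N -> (0 < N)%N -> 0 < kappa ->
  exists E, [/\ measurable E, ((1 - 2 * delta)%:E <= P E)%E &
    forall w, E w -> r_ (thetahat w) - r_ theta0 <=
      2 * kappa * mH + c2 * f (alpha * kappa) / alpha * mlH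
      + (c2 + 1) * f alpha / alpha * rl
      + (n%:R * alpha)^-1 * ln (N%:R / delta ^+ 2)
      + rho * norm2 theta0 ^+ 2].
Proof.
move=> T0 cov N0 kappa0.
have [E1 [mE1 PE1 hE1]] := upper_deviation T0 hdelta.
have [E2 [mE2 PE2 hE2]] := uniform_lower_deviation cov N0 kappa0 hdelta.
exists (E1 `&` E2); split; first exact: measurableI.
  apply: prob_setC_le; first exact: measurableI.
  rewrite setCI; apply: (le_trans (measureU2 _ _ _)).
  - exact: measurableC.
  - exact: measurableC.
  - have -> : ((2 * delta)%:E = delta%:E + delta%:E)%E.
      by rewrite -EFinD mulr2n mulrDl mul1r.
    by apply: (@leeD R (P (~` E1)) _ (P (~` E2))); [exact: PE1|exact: PE2].
move=> w [/hE1 U /hE2 /(_ (hatT w)) L].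
have na0 : 0 < n%:R * alpha by rewrite mulr_gt0// ltr0n.
have [_ /(_ _ T0) hmin] := hthetahat w.
rewrite /emp_risk in hmin.
have lnE : ln (N%:R / delta ^+ 2) = ln (N%:R / delta) + ln delta^-1.
  have Nd : 0 < N%:R / delta by rewrite divr_gt0// ltr0n.
  by rewrite -lnM ?posrE ?invr_gt0// expr2 invfM mulrA.
have hatn : 0 <= rho * norm2 (thetahat w) ^+ 2.
  by rewrite mulr_ge0 ?sqr_ge0// ltW.
set SU := \sum_(i < n) _ in U hmin; set SL := \sum_(i < n) _ in L hmin.
have : SL <= SU + (n%:R * alpha) * (rho * norm2 theta0 ^+ 2).
  rewrite -(ler_pM2l (x := (n%:R * alpha)^-1)) ?invr_gt0//.
  rewrite mulrDr mulKf ?gt_eqF//.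
  lra.
move=> hSL; rewrite lnE -(ler_pM2l na0).
rewrite [leRHS](_ : _ = n%:R * (2 * (alpha * kappa) * mH
    + c2 * f (alpha * kappa) * mlH + (c2 + 1) * f alpha * rl)
    + (ln (N%:R / delta) + ln delta^-1)
    + n%:R * alpha * (rho * norm2 theta0 ^+ 2)); last first.
  by field; rewrite pnatr_eq0 -lt0n hn gt_eqF.
lra.
Qed.

(* Theta need not be measurable, but the risk is Lipschitz on it, so the
   sublevel set is relatively closed in Theta. *)
Lemma measurable_risk_le (t : R) : measurable [set w | r_ (thetahat w) <= t].
Proof.
pose S := [set theta | Theta theta /\ r_ theta <= t].
have SE : [set w | r_ (thetahat w) <= t] = thetahat @^-1` closure S.
  apply/seteqP; split => w /= rt.
    by apply: subset_closure; split.
  apply/ler_addgt0Pr => e e0.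
  (* A sup-norm move below [e'] changes the Euclidean norm by at most [p.+1%:R * e'], hence the risk
     by at most [e]; [mH + 1] covers the case [mH = 0]. *)
  pose e' := e / ((mH + 1) * p.+1%:R).
  have mH1 : 0 < mH + 1 by rewrite ltr_wpDl// mH_ge0.
  have e'0 : 0 < e' by rewrite divr_gt0// mulr_gt0// ltr0n.
  have [s [[sT st]]] := rt _ (nbhsx_ballx (thetahat w : 'rV[R]_p) e' e'0).
  rewrite -ball_normE /= => hs.
  apply: (le_trans (risk_lipschitz sT (hatT w))); apply: lerD => //.
  apply: (@le_trans _ _ (p.+1%:R * e' * (mH + 1))).
    apply: ler_pM => //; [exact: norm2_ge0|exact: mH_ge0| |by rewrite lerDl].
    by apply: (le_trans (norm2_le_norm _)); rewrite ler_wpM2l// ltW.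
  rewrite le_eqVlt; apply/orP; left; apply/eqP; rewrite /e'; field.
  by rewrite gt_eqF//= gt_eqF.
rewrite SE -[X in measurable X]setTI.
apply: measurable_funPT => //.
rewrite -[closure S]setCK; apply: measurableC; apply: sub_sigma_algebra.
by apply: closed_openC; exact: closed_closure.
Qed.

(** The event [E] depends on the minimizer, and infinitely many such events cannot be intersected.
    For each level above the target, one minimizer of nearly least norm is used, and only the
    probabilities pass to the limit. *)
Lemma excess_risk_prob (C : R) :
  (forall theta0, argmin Theta (risk P Z0 l) theta0 ->
    exists E, [/\ measurable E, ((1 - 2 * delta)%:E <= P E)%E &
      forall w, E w -> r_ (thetahat w) - r_ theta0 <=
        C + rho * norm2 theta0 ^+ 2]) ->
  ((1 - 2 * delta)%:E <= P [set w | excess_risk P Z0 l Theta (thetahat w) <=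
    C%:E + rho%:E * norm_argmin_risk P Z0 l Theta ^+ 2])%E.
Proof.
move=> hC.
(* Without a minimizer the right-hand side is [+oo], so the event is the whole space. *)
have [A0|] := eqVneq (argmin Theta (risk P Z0 l)) set0.
  rewrite (_ : [set w | _] = [set: Omega]).
    by rewrite probability_setT lee_fin lerBlDr lerDl mulr_ge0// ltW.
  rewrite /norm_argmin_risk A0 image_set0 ereal_inf0 expe2 mulyy.
  rewrite gt0_muley ?lte_fin// addey//.
  by apply/seteqP; split => // w _; exact: leey.
move=> /set0P[theta0 [T0 min0]].
have infE :
    ereal_inf [set risk P Z0 l theta' | theta' in Theta] = (r_ theta0)%:E.
  apply/eqP; rewrite eq_le; apply/andP; split.
    by rewrite -riskE//; apply: ereal_inf_lbound; exists theta0.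
  by apply: le_ereal_inf_tmp => _ [theta Tt <-]; rewrite -riskE//; exact: min0.
have excessE w : excess_risk P Z0 l Theta (thetahat w) =
    (r_ (thetahat w) - r_ theta0)%:E.
  by rewrite /excess_risk infE riskE.
set m := norm_argmin_risk P Z0 l Theta.
have m0 : (0 <= m)%E.
  apply: le_ereal_inf_tmp => _ [theta _ <-].
  by rewrite lee_fin norm2_ge0.
have mfin : m \is a fin_num.
  rewrite ge0_fin_numE//; apply: (@le_lt_trans _ _ (norm2 theta0)%:E).
    by apply: ereal_inf_lbound; exists theta0.
  exact: ltry.
have -> : (C%:E + rho%:E * m ^+ 2 = (C + rho * fine m ^+ 2)%:E)%E.
  by rewrite EFinD EFinM EFin_expe fineK.
under eq_set do rewrite excessE lee_fin.
have fm0 : 0 <= fine m by exact: fine_ge0.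
have mX t : measurable [set w | r_ (thetahat w) - r_ theta0 <= t].
  by under eq_set do rewrite lerBlDr; exact: measurable_risk_le.
(* The minimal norm over the minimizers need not be attained: Theta need not be
   closed. *)
apply: (prob_le_right_limit (X := fun w => r_ (thetahat w) - r_ theta0)) => //.
move=> t Ct.
(* A minimizer with squared norm at most [(t - C) / rho] has bound at most [t]; the strict
   inequality here ensures that one exists. *)
have tC : fine m ^+ 2 < (t - C) / rho.
  by rewrite ltr_pdivlMr// mulrC ltrBrDl.
have tC0 : 0 <= (t - C) / rho by rewrite (le_trans _ (ltW tC))// sqr_ge0.
have : (m < (Num.sqrt ((t - C) / rho))%:E)%E.
  rewrite -(fineK mfin) lte_fin -[ltLHS](ger0_norm fm0) -sqrtr_sqr ltr_sqrt//.
  exact: le_lt_trans (sqr_ge0 _) tC.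
move=> /ereal_inf_lt[_ [theta1 A1 <-]]; rewrite lte_fin => lt1.
have [E [mE PE hE]] := hC _ A1.
have r1 : r_ theta1 = r_ theta0.
  have [T1 min1] := A1.
  apply/eqP; rewrite eq_le -!lee_fin -!riskE//.
  by rewrite min1// min0.
apply: (le_trans PE); apply: le_measure.
- exact: mem_set.
- exact/mem_set/mX.
move=> w /hE /=; rewrite r1 => /le_trans; apply.
rewrite -lerBrDl mulrC -ler_pdivlMr//.
rewrite -[leRHS]sqr_sqrtr// ler_pXn2r ?nnegrE ?norm2_ge0 ?sqrtr_ge0//.
exact: ltW.
Qed.

End Estimator.

End RobustRiskMinimization.

(** * The general bound and the choice [kappa = 1 / n] *)

Unset Implicit Arguments.

Theorem theorem2 (R : realType) (d : measure_display)
  (Omega : measurableType d) (P : probability Omega R)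
  (k p n : nat) (hn : (0 < n)%N)
  (Z0 : {mfun Omega >-> (borelRV R k * R)%type})
  (Z : 'I_n -> {mfun Omega >-> (borelRV R k * R)%type})
  (hiid : iid_copies P Z0 Z)
  (Theta : set 'rV[R]_p)
  (l : R -> 'rV[R]_k -> 'rV[R]_p -> R)
  (hl : forall theta, Theta theta ->
     measurable_fun [set: (borelRV R k * R)%type] (loss_at l theta))
  (lambda f : R -> R) (c2 : R) (hC1 : growth_condition lambda f c2)
  (hC2 : convex_set (Theta : set (convex_lmodType 'rV[R]_p)) /\
     exists r : R, 0 < r /\ forall theta, Theta theta -> norm2 theta <= r)
  (H : R -> 'rV[R]_k -> R)
  (hH : measurable_fun [set: (borelRV R k * R)%type]
          (fun z : borelRV R k * R => H z.2 z.1))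
  (hH0 : forall y x, 0 <= H y x)
  (hC3 : forall y x theta1 theta2, Theta theta1 -> Theta theta2 ->
     `|l y x theta2 - l y x theta1| <= H y x * norm2 (theta2 - theta1))
  (hC4 : ('E_P[fun w => lambda (H (Z0 w).2 (Z0 w).1)] < +oo)%E)
  (hC5 : (sup_lrisk P Z0 l lambda Theta < +oo)%E)
  (psi : R -> R) (hpsi : truncation_function lambda psi)
  (alpha rho : R) (halpha : 0 < alpha) (hrho : 0 < rho)
  (thetahat : {mfun Omega >-> borelRV R p})
  (hthetahat : forall w, argmin Theta
     (fun theta => emp_risk Z l psi alpha w theta + rho * norm2 theta ^+ 2)
     (thetahat w))
  (delta : R) (hdelta : 0 < delta < 1 / 2) :
  let EH := 'E_P[fun w => H (Z0 w).2 (Z0 w).1]%E in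
  let ElH := 'E_P[fun w => lambda (H (Z0 w).2 (Z0 w).1)]%E in
  let RlTheta := sup_lrisk P Z0 l lambda Theta in
  let normThetastar := norm_argmin_risk P Z0 l Theta in
  let logN := fun e : R =>
    ln ((covering_number Theta e)%:R / delta ^+ 2) in
  (forall kappa : R, 0 < kappa ->
     ((1 - 2 * delta)%:E <= P [set w |
        excess_risk P Z0 l Theta (thetahat w) <=
          (2 * kappa)%:E *
            (EH + (c2 * f (alpha * kappa) / (alpha * kappa))%:E * ElH)
          + ((c2 + 1) * f alpha / alpha)%:E * RlTheta
          + (1 / (n%:R * alpha) * logN kappa)%:E
          + rho%:E * normThetastar ^+ 2])%E)
  /\
  (f alpha = 1 / (n%:R * (c2 + 1)) * (fine RlTheta)^-1 * logN n%:R^-1 ->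
     ((1 - 2 * delta)%:E <= P [set w |
        excess_risk P Z0 l Theta (thetahat w) <=
          (2 : R)%:E * EH * (n%:R^-1)%:E
          + (c2%:E * ElH * (alpha^-1)%:E) * (f (alpha / n%:R))%:E
          + (2 / (n%:R * alpha) * logN n%:R^-1)%:E
          + rho%:E * normThetastar ^+ 2])%E).
Proof.
move=> EH ElH RlTheta normThetastar logN.
have [_ [r [r0 hr]]] := hC2.
have /andP[delta0 _] := hdelta.
have [_ [c20 f0 _ _ _]] := hC1.
(* A probability space is nonempty, and the estimator takes its values in [Theta]. *)
have [theta1 T1] : Theta !=set0.
  have : [set: Omega] !=set0.
    apply/set0P/negP => /eqP O0.
    have := probability_setT P; rewrite O0 measure0 => /eqP.
    by rewrite eqe eq_sym oner_eq0.
  by move=> [w _]; exists (thetahat w); have [] := hthetahat w.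
have hcov kappa : 0 < kappa ->
    covered_by Theta kappa (covering_number Theta kappa) /\
    (0 < covering_number Theta kappa)%N.
  move=> kappa0; have cov := covered_by_covering_number hr kappa0.
  split=> //; have [c [_ /(_ _ T1)[i _]]] := cov.
  exact: leq_ltn_trans (ltn_ord i).
have -> : EH = (fine EH)%:E.
  by rewrite /EH (expected_H hC1 hH hH0 hC4).
have -> : ElH = (fine ElH)%:E.
  by rewrite /ElH (expected_lambda_H hC1 hH hH0 hC4).
have RE : RlTheta = (fine RlTheta)%:E.
  by rewrite /RlTheta (sup_lriskE hC1 hC5)//; exists theta1.
have na0 : 0 < n%:R * alpha by rewrite mulr_gt0// ltr0n.
have mlH0 : 0 <= fine ElH.
  rewrite /ElH; apply/fine_ge0/expectation_ge0 => w.
  exact/(growth_ge0 hC1)/hH0.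
(* Common form of both claims. The penalty stays out of [C], because [excess_risk_prob] replaces the
   norm of a minimizer by [normThetastar]. *)
have oracle (kappa C : R) : 0 < kappa ->
  2 * kappa * fine EH + c2 * f (alpha * kappa) / alpha * fine ElH
    + (c2 + 1) * f alpha / alpha * fine RlTheta
    + (n%:R * alpha)^-1 * logN kappa <= C ->
  ((1 - 2 * delta)%:E <= P [set w | excess_risk P Z0 l Theta (thetahat w) <=
    C%:E + rho%:E * normThetastar ^+ 2])%E.
  move=> kappa0 leC; have [cov N0] := hcov _ kappa0.
  apply: (excess_risk_prob hl hC1 hH hH0 hC3 hC4 hC5 hrho delta0 hthetahat).
  move=> theta0 [T0 _].
  have [E [mE PE hE]] := oracle_inequality hn hiid hl hC1 hH hH0 hC3 hC4 hC5
    hpsi halpha hrho delta0 hthetahat T0 cov N0 kappa0.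
  exists E; split=> // w /hE /le_trans; apply.
  rewrite lerD2r (le_trans _ leC)// /EH /ElH.
  by rewrite (expected_H hC1 hH hH0 hC4) (expected_lambda_H hC1 hH hH0 hC4).
split=> [kappa kappa0|fE].
- rewrite RE; apply: (oracle kappa (2 * kappa * (fine EH +
    c2 * f (alpha * kappa) / (alpha * kappa) * fine ElH)
    + (c2 + 1) * f alpha / alpha * fine RlTheta
    + 1 / (n%:R * alpha) * logN kappa)) => //.
  rewrite div1r 2!lerD2r mulrDr lerD2l.
  (* After cancelling [kappa], the stated term is twice the nonnegative one from
     [oracle_inequality]. *)
  have -> : 2 * kappa * (c2 * f (alpha * kappa) / (alpha * kappa) * fine ElH) =
      2 * (c2 * f (alpha * kappa) / alpha * fine ElH).
    by field; rewrite !gt_eqF.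
  rewrite ler_peMl ?ler1n// mulr_ge0// divr_ge0 ?(ltW halpha)//.
  rewrite mulr_ge0 ?(ltW c20)//.
  by rewrite f0// mulr_gt0.
- have n0 : 0 < n%:R :> R by rewrite ltr0n.
  have ni0 : 0 < n%:R^-1 :> R by rewrite invr_gt0.
  apply: (oracle n%:R^-1 (2 * fine EH * n%:R^-1
    + c2 * fine ElH * alpha^-1 * f (alpha / n%:R)
    + 2 / (n%:R * alpha) * logN n%:R^-1)) => //.
  have [_ N0] := hcov _ ni0.
  have L0 : 0 <= logN n%:R^-1.
    rewrite ln_ge0// ler_pdivlMr ?exprn_gt0// mul1r.
    apply: (@le_trans _ _ 1); last by rewrite ler1n.
    by rewrite exprn_ile1//; lra.
  (* The choice of [alpha] makes the truncation term equal to the covering term, hence the final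
     factor 2. If [fine RlTheta] is 0, its inverse is 0 too and [fE] does not give this equality;
     the left side then vanishes and [L0] suffices. *)
  have key : (c2 + 1) * f alpha / alpha * fine RlTheta <=
      (n%:R * alpha)^-1 * logN n%:R^-1.
    have [->|rl0] := eqVneq (fine RlTheta) 0.
      by rewrite mulr0 mulr_ge0// invr_ge0 ltW.
    rewrite fE le_eqVlt; apply/orP; left; apply/eqP; field.
    by rewrite rl0 !gt_eqF// ltr_wpDl// ltW.
  have -> : 2 / (n%:R * alpha) * logN n%:R^-1 =
      (n%:R * alpha)^-1 * logN n%:R^-1 + (n%:R * alpha)^-1 * logN n%:R^-1.
    by rewrite -mulrA mulr2n mulrDl mul1r.
  rewrite -[alpha / n%:R]/(alpha * n%:R^-1).
  lra.
Qed.
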